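(* Let $p$ be an odd prime and $n>0$, let $D$ be a $p^{n}$-periodic diagram of a link and let $0\le m\le n$. Then $$\mathrm{DJ}_{n,n-m}(D)=(-1)^{n_{-}(D)}q^{n_{+}(D)-2n_{-}(D)}\sum_{m\le v\le n}\ \sum_{s\in\mathcal{S}^{p^{v}}(D)}(-q)^{r(s)}\,\mathrm{DJ}_{v,v-m}(s),$$ where $\mathcal{S}^{p^{v}}(D)$ is the set of all Kauffman states of $D$ which inherit from $D$ a symmetry of order $p^{v}$, i.e. whose stabilizer in $\mathbb{Z}/p^{n}$ has order exactly $p^{v}$, and in the sum each such state $s$ is regarded as a crossingless $p^{v}$-periodic diagram with respect to its stabilizer.
   Context: Periodic diagrams. An $N$-periodic link diagram $D$ is an oriented planar link diagram which is invariant (including crossing information and orientation) under the rotation of the plane by $2\pi/N$ about a point $F$ not lying on $D$ (the projection of the rotation axis). Thus $\mathbb{Z}/N$ acts on $D$ and on its set of Kauffman states. Let $n_{+}(D)$, $n_{-}(D)$ be the numbers of positive and negative crossings. Khovanov complex. A Kauffman state $s$ of $D$ is a choice of $0$- or $1$-smoothing at each crossing (identified with the resulting crossingless diagram); the orientation-preserving resolution is the $0$-smoothing at a positive crossing and the $1$-smoothing at a negative crossing. Let $r(s)$ be the number of $1$-smoothings. Let $A=\mathbb{Q}v_{+}\oplus\mathbb{Q}v_{-}$, $\deg v_{\pm}=\pm1$, with multiplication $v_+v_+=v_+$, $v_+v_-=v_-v_+=v_-$, $v_-v_-=0$ and comultiplication $v_+\mapsto v_+\otimes v_-+v_-\otimes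 v_+$, $v_-\mapsto v_-\otimes v_-$. The Khovanov complex $\mathrm{CKh}^{i,j}(D;\mathbb{Q})$ is the direct sum, over states $s$ with $r(s)=i+n_{-}(D)$, of the part of $A^{\otimes\{\text{circles of }s\}}\otimes\Lambda^{r(s)}\mathbb{Q}^{\{1\text{-smoothed crossings of }s\}}$ of degree $j-r(s)-n_{+}(D)+2n_{-}(D)$ (the exterior power in degree $0$); the differential is the sum, over changes of one $0$-smoothing at a crossing $c$ to a $1$-smoothing, of the merge (multiplication) or split (comultiplication) map tensored with exterior multiplication by $c$. The rotation permutes crossings, states and circles, so $\mathbb{Z}/N$ acts and $\mathrm{CKh}(D;\mathbb{Q})$ is a complex of graded $\mathbb{Q}[\mathbb{Z}/N]$-modules. For a crossingless diagram the complex is $A^{\otimes\{\text{circles}\}}$ in homological degree $0$, with the group permuting tensor factors (orientations play no role). Equivariant homology. For $d\mid N$ let $\xi_d$ be a primitive $d$-th root of unity, and let a generator of $\mathbb{Z}/N$ act on the cyclotomic field $\mathbb{Q}[\xi_d]$ by multiplication by $\xi_d$. Put $$\mathrm{Kh}^{*,*,d}_{\mathbb{Z}/N}(D;\mathbb{Q})=H^{*,*}\left(\mathrm{Hom}_{\mathbb{Q}[\mathbb{Z}/N]}(\mathbb{Q}[\xi_d],\mathrm{CKh}(D;\mathbb{Q}))\right),$$ a $\mathbb{Q}[\xi_d]$-vector space, and $$\mathrm{J}_{N,d}(D)(q)=\sum_{i,j}(-1)^{i}q^{j}\dim_{\mathbb{Q}[\xi_d]}\mathrm{Kh}^{i,j,d}_{\mathbb{Z}/N}(D;\mathbb{Q}).$$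 Difference Jones polynomials. For a $p^{v}$-periodic diagram $D$ ($v\ge 0$) and $0\le u\le v$ put $\mathrm{DJ}_{v,u}(D)=\mathrm{J}_{p^{v},p^{u}}(D)-\mathrm{J}_{p^{v},p^{u+1}}(D)$, with the convention $\mathrm{J}_{p^{v},p^{v+1}}=0$.
   Formalization: The inner sum takes one Kauffman state from each Z/p^n-orbit in S^{p^v}(D), not every state; summing over all states is false, e.g. for p=3, n=1, m=0 and the 3-periodic trefoil (closure of σ₁³), where the left side is 0 and the right side is 2q^5+2q^7. *)

(* Defs.v *)
From HB Require Import structures.
From mathcomp Require Import all_boot all_order all_algebra all_field.

Set Implicit Arguments.
Unset Strict Implicit.
Unset Printing Implicit Defensive.

Import GRing.Theory.
Local Open Scope ring_scope.

Fact cyclotomic_root_exists (d : nat) :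
  {z : algC | (0 < d)%N -> d.-primitive_root z}.
Proof.
case: d => [|d]; first by exists 1.
by have [z zP] := C_prim_root_exists (ltn0Sn d); exists z.
Qed.

Definition cyclotomic_root (d : nat) : algC := sval (cyclotomic_root_exists d).

Definition Qxi (d : nat) : fieldExtType rat :=
  projT1 (num_field_exists [:: cyclotomic_root d]).

Fact xi_exists (d : nat) :
  {x : Qxi d | ((0 < d)%N -> d.-primitive_root x) & <<1; x>>%VS = fullv}.
Proof.
rewrite /Qxi; case: num_field_exists => K [f] [[|x []] //= [xE] genx].
exists x; last by rewrite -genx adjoin_seq1.
move=> d_gt0; have := svalP (cyclotomic_root_exists d) d_gt0.
by rewrite -/(cyclotomic_root d) -xE fmorph_primitive_root.
Qed.

Definition xi (d : nat) : Qxi d := s2val (xi_exists d).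

Lemma xi_prim d : (0 < d)%N -> d.-primitive_root (xi d).
Proof. by rewrite /xi; case: xi_exists. Qed.

Lemma xi_full d : <<1; xi d>>%VS = fullv.
Proof. by rewrite /xi; case: xi_exists. Qed.

(* Q-linear maps K -> V, viewed as a K-vector space through                    *)
(* (a *: f) x = f (a * x); its dimension below is the one over K              *)
Definition homK (K : fieldExtType rat) (V : vectType rat) : Type := 'Hom(K, V).

Section HomK.
Variables (K : fieldExtType rat) (V : vectType rat).

HB.instance Definition _ := GRing.Zmodule.on (homK K V).

Definition homK_scale (a : K) (f : homK K V) : homK K V :=
  ((f : 'Hom(K, V)) \o amulr a)%VF.

Fact homK_scaleE a (f : homK K V) x :
  (homK_scale a f : 'Hom(K, V)) x = (f : 'Hom(K, V)) (a * x).
Proof. by rewrite lfunE /= lfunE /= mulrC. Qed.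

Fact homK_scaleA a b (f : homK K V) :
  homK_scale a (homK_scale b f) = homK_scale (a * b) f.
Proof. by apply/lfunP => x; rewrite !homK_scaleE mulrA [b * a]mulrC. Qed.

Fact homK_scale1 : left_id 1 homK_scale.
Proof. by move=> f; apply/lfunP => x; rewrite homK_scaleE mul1r. Qed.

Fact homK_scaleDr : right_distributive homK_scale +%R.
Proof.
move=> a f g; apply/lfunP => x.
by rewrite homK_scaleE [LHS]add_lfunE [RHS]add_lfunE !homK_scaleE.
Qed.

Fact homK_scaleDl f : {morph homK_scale^~ f : a b / a + b}.
Proof.
move=> a b; apply/lfunP => x.
by rewrite homK_scaleE [RHS]add_lfunE !homK_scaleE mulrDl linearD.
Qed.

HB.instance Definition _ := GRing.Zmodule_isLmodule.Build K (homK K V)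
  homK_scaleA homK_scale1 homK_scaleDr homK_scaleDl.

Lemma homKZE (a : K) (f : homK K V) x :
  ((a *: f : homK K V) : 'Hom(K, V)) x = (f : 'Hom(K, V)) (a * x).
Proof. exact: homK_scaleE. Qed.

Let n : nat := \dim {:K}.
Let e : n.-tuple K := vbasis {:K}.
(* every Q-linear form on K is x |-> phi (a * x) for a unique a               *)
Let i0 : 'I_n := Ordinal (adim_gt0 {:K}).
Local Notation phi := (coord e i0).

Let eP (x : K) : x = \sum_(i < n) coord e i x *: e`_i.
Proof. exact: coord_vbasis (memvf x). Qed.

Let phi_inj (a : K) : (forall x, phi (a * x) = 0) -> a = 0.
Proof.
move=> a0; apply/eqP/negPn/negP => an0.
have := a0 (a^-1 * e`_i0); rewrite mulVKf // coord_free ?eqxx //.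
by rewrite (basis_free (vbasisP _)).
Qed.

Let gram (a : K) : K := \sum_(i < n) phi (a * e`_i) *: e`_i.

Let gram_linear : linear gram.
Proof.
move=> k a b; rewrite /gram scaler_sumr -big_split; apply: eq_bigr => i _ /=.
by rewrite mulrDl -scalerAl linearP scalerDl scalerA.
Qed.
HB.instance Definition _ := GRing.isLinear.Build rat K K _ gram gram_linear.

Let coord_sum (c : 'I_n -> rat) i : coord e i (\sum_(j < n) c j *: e`_j) = c i.
Proof. by rewrite coord_sum_free // (basis_free (vbasisP _)). Qed.

Let gramP (a : K) (g : {scalar K}) :
  gram a = \sum_(i < n) g e`_i *: e`_i <-> forall x, phi (a * x) = g x.
Proof.
split=> [ag x|ag]; last by apply: eq_bigr => i _; rewrite ag.
have agi (i : 'I_n) : phi (a * e`_i) = g e`_i.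
  by have := congr1 (coord e i) ag; rewrite !coord_sum.
rewrite [x]eP mulr_sumr !linear_sum; apply: eq_bigr => i _.
by rewrite -scalerAr !linearZ /= agi.
Qed.

Let gram_lker0 : lker (linfun gram) == 0%VS.
Proof.
apply/eqP/vspaceP => a; rewrite memv_ker memv0 lfunE /=; apply/eqP/eqP => [a0|->].
  apply: phi_inj; apply/(gramP a (\0 : {scalar K})).
  by rewrite a0 big1 // => i _; rewrite scale0r.
by rewrite linear0.
Qed.

Let rep (g : K -> rat) : K := (linfun gram)^-1%VF (\sum_(i < n) g e`_i *: e`_i).

Let repP (g : {scalar K}) x : phi (rep g * x) = g x.
Proof.
apply/gramP: x.
by rewrite -[LHS](lfunE gram) /rep lker0_lfunVK.
Qed.

Let repU (g : {scalar K}) a : (forall x, phi (a * x) = g x) -> a = rep g.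
Proof.
move=> ag; apply/eqP; rewrite -subr_eq0; apply/eqP/phi_inj => x.
by rewrite mulrBl linearB /= ag repP subrr.
Qed.

Let m : nat := \dim {:V}.
Let b : m.-tuple V := vbasis {:V}.
Let comp (f : homK K V) (i : 'I_m) : {scalar K} := coord b i \o (f : 'Hom(K, V)).
Let rows (f : homK K V) : 'rV[K]_m := \row_i rep (comp f i).

Fact homK_vect_iso : Vector.axiom m (homK K V).
Proof.
exists rows.
  move=> a f g; apply/rowP => i; rewrite !mxE; apply/esym/repU => x.
  rewrite mulrDl linearD /= -mulrA mulrCA !repP /= [RHS]/=.
  by rewrite [in RHS]add_lfunE linearD; congr (coord b i _ + _); rewrite homK_scaleE.
have rowsE f x : (f : 'Hom(K, V)) x = \sum_(i < m) phi (rows f 0 i * x) *: b`_i.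
  rewrite [LHS](coord_vbasis (memvf _)); apply: eq_bigr => i _.
  by rewrite mxE repP.
pose unrow (r : 'rV[K]_m) (x : K) : V := \sum_(i < m) phi (r 0 i * x) *: b`_i.
have unrow_linear r : linear (unrow r).
  move=> k x y; rewrite /unrow scaler_sumr -big_split; apply: eq_bigr => i _ /=.
  by rewrite mulrDr -scalerAr linearP scalerDl scalerA.
pose unrowL r := HB.pack_for {linear K -> V} (unrow r)
  (GRing.isLinear.Build rat K V _ (unrow r) (unrow_linear r)).
exists (fun r => linfun (unrowL r) : homK K V) => [f|r].
  by apply/lfunP => x; rewrite lfunE /= /unrow [RHS]rowsE.
apply/rowP => i; rewrite mxE; apply/esym/repU => x.
by rewrite /= (lfunE (unrowL r)) /= coord_sum_free // (basis_free (vbasisP _)).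
Qed.
HB.instance Definition _ := Lmodule_hasFinDim.Build K (homK K V) homK_vect_iso.
End HomK.

Section Postcomposition.
Variables (K : fieldExtType rat) (V : vectType rat) (g : 'End(V)).

Definition post_fun (f : homK K V) : homK K V := (g \o (f : 'Hom(K, V)))%VF.

Fact post_fun_linear : linear post_fun.
Proof.
move=> a f h; apply/lfunP => x.
rewrite [RHS]add_lfunE [LHS]comp_lfunE [in LHS]add_lfunE linearD.
rewrite [(post_fun h : 'Hom(_, _)) x]comp_lfunE; congr (_ + _).
by rewrite !homKZE comp_lfunE.
Qed.
HB.instance Definition _ :=
  GRing.isLinear.Build K (homK K V) (homK K V) _ post_fun post_fun_linear.

Definition post : 'End(homK K V) := linfun post_fun.
End Postcomposition.

(******************************************************************************)
(*                        Oriented planar link diagrams                       *)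
(******************************************************************************)

(* A diagram is recorded as a planar diagram code.  The end (c, i) of a       *)
(* crossing c is its i-th end, counted counterclockwise from the incoming end *)
(* of the lower strand, so the lower strand runs from (c, 0) to (c, 2).  With *)
(* this numbering the upper strand runs from (c, 3) to (c, 1) if c is         *)
(* positive and from (c, 1) to (c, 3) if c is negative.  [opp] sends an end   *)
(* to the other end of the edge that starts there; [loop] is the set of       *)
(* components without crossings.                                              *)
Definition outgoing (C : Type) (pos : C -> bool) (e : C * 'Z_4) : bool :=
  (e.2 == 2) || (e.2 == (if pos e.1 then 1 else 3)).

Record link_diagram := LinkDiagram {
  crossing : finType;
  loop : finType;
  opp : crossing * 'Z_4 -> crossing * 'Z_4;
  positive : crossing -> bool;
  oppK : involutive opp;
  opp_outgoing : forall e, outgoing positive (opp e) = ~~ outgoing positive e }.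

Definition dart (D : link_diagram) : finType := (crossing D * 'Z_4)%type.

Definition n_pos (D : link_diagram) : nat := #|[set c : crossing D | positive c]|.
Definition n_neg (D : link_diagram) : nat :=
  #|[set c : crossing D | ~~ positive c]|.

(* The regions of the plane cut out by a diagram.  [left e] is the region on  *)
(* the left of the edge at e when one walks away from e, i.e. the region in   *)
(* the corner between the ends e and e + 1.  Walking along an edge with a     *)
(* region on the left and turning left at the crossing, one follows a         *)
(* boundary component of that region; these components are the orbits of      *)
(* [next].  A loop is oriented, and has a region on either side.              *)
Section Planar.
Variable D : link_diagram.

Definition next (e : dart D) : dart D := ((opp e).1, (opp e).2 - 1).

Record regions := Regions {
  region : finType;
  left : dart D -> region;
  loop_left : loop D -> region;
  loop_right : loop D -> region }.

Definition adjacent (R : regions) (r r' : region R) : bool :=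
  [exists e, (left R e == r) && (left R (opp e) == r')]
  || [exists l, ((loop_left R l == r) && (loop_right R l == r'))
             || ((loop_right R l == r) && (loop_left R l == r'))].

(* Glue to the diagram, for each region, a sphere with one hole for each of   *)
(* its boundary components.  The resulting closed surface is the sphere iff   *)
(* it is connected and has Euler characteristic                               *)
(*   #|crossing| - 2 * #|crossing|                                            *)
(*     + 2 * #|region| - (number of boundary components) = 2.                 *)
Definition planar (R : regions) : Prop :=
  [/\ forall e, left R (next e) = left R e,
      forall r r', connect (adjacent (R := R)) r r'
    & (2 * #|region R| =
       #|crossing D| + (fcard next predT + 2 * #|loop D|) + 2)%N].

(* The action of a generator of Z/N; crossings are moved without changing the *)
(* numbering of their ends.                                                   *)
Record symmetry := Symmetry {
  turn_crossing : crossing D -> crossing D;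
  turn_loop : loop D -> loop D }.

Definition turn_dart (rho : symmetry) (e : dart D) : dart D :=
  (turn_crossing rho e.1, e.2).

(* rho is the rotation by 2 * pi / N about a point F in the region [center],  *)
(* [outer] being the unbounded region.  Choose a ray from F to infinity that  *)
(* avoids the crossings; it and its images under the rotation cut the plane   *)
(* into N sectors, numbered counterclockwise.  [sector c] is the sector of c, *)
(* modulo N; [angle e] is the signed number of rays met by the edge at e      *)
(* (counterclockwise counted positively) when one walks away from e, and      *)
(* [loop_angle l] is the same for the loop l.  Along the oriented boundary of *)
(* a region the total is the number of rays which start in the region minus   *)
(* the number of those which end in it.  As F is not on the diagram, a loop   *)
(* that is mapped to itself by a nontrivial rotation encircles F.             *)
Record rotation (N : nat) (R : regions) (rho : symmetry) := Rotation {
  turn_region : region R -> region R;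
  center : region R;
  outer : region R;
  sector : crossing D -> int;
  angle : dart D -> int;
  loop_angle : loop D -> int;
  _ : forall e, opp (turn_dart rho e) = turn_dart rho (opp e);
  _ : forall c, positive (turn_crossing rho c) = positive c;
  _ : forall c, iter N (turn_crossing rho) c = c;
  _ : forall l, iter N (turn_loop rho) l = l;
  _ : forall e, left R (turn_dart rho e) = turn_region (left R e);
  _ : forall l, loop_left R (turn_loop rho l) = turn_region (loop_left R l);
  _ : forall l, loop_right R (turn_loop rho l) = turn_region (loop_right R l);
  _ : turn_region center = center;
  _ : turn_region outer = outer;
  _ : forall c, (sector (turn_crossing rho c) = sector c + 1 %[mod N])%Z;
  _ : forall e, (angle e = sector (opp e).1 - sector e.1 %[mod N])%Z;
  _ : forall e, angle (opp e) = - angle e;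
  _ : forall e, angle (turn_dart rho e) = angle e;
  _ : forall l, loop_angle (turn_loop rho l) = loop_angle l;
  _ : forall r, \sum_(e | left R e == r) angle e
        + \sum_(l | loop_left R l == r) loop_angle l
        - \sum_(l | loop_right R l == r) loop_angle l
      = N%:Z *+ (r == center) - N%:Z *+ (r == outer);
  _ : forall k l, (0 < k < N)%N -> iter k (turn_loop rho) l = l ->
        loop_angle l != 0 }.

Definition periodic (N : nat) (rho : symmetry) : Prop :=
  exists R : regions, planar R /\ inhabited (rotation N R rho).

End Planar.

(******************************************************************************)
(*                     Kauffman states and their circles                      *)
(******************************************************************************)

Section KhovanovComplex.
Variable D : link_diagram.

(* A state is given by the set of its 1-smoothed crossings, so r(s) = #|s|.   *)
Definition state : finType := {set crossing D}.

(* The 0-smoothing joins end 0 to 1 and end 2 to 3, the 1-smoothing joins end *)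
(* 0 to 3 and end 1 to 2: at a positive crossing the former, at a negative    *)
(* crossing the latter, joins incoming ends to outgoing ends.                 *)
Definition smooth (s : state) (e : dart D) : dart D :=
  (e.1, if (e.1 \in s) (+) odd e.2 then e.2 - 1 else e.2 + 1).

Definition piece : finType := (dart D + loop D)%type.

Definition linked (s : state) (x y : piece) : bool :=
  match x, y with
  | inl e, inl e' => (e' == opp e) || (e' == smooth s e)
  | _, _ => false
  end.

Definition circles (s : state) : {set {set piece}} :=
  [set [set y | connect (linked s) x y] | x : piece].

(* The standard basis of the complex: a state s and the set m of the circles  *)
(* of s which carry v_-, the other ones carrying v_+.  The basis vector       *)
(* includes the generator c_1 /\ ... /\ c_r of the exterior power, where        *)
(* c_1 < ... < c_r are the elements of s in the order of [enum_rank].         *)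
Definition enhanced_state : finType :=
  {x : state * {set {set piece}} | x.2 \subset circles x.1}.

Implicit Types b : enhanced_state.
Definition st b : state := (val b).1.
Definition minus b : {set {set piece}} := (val b).2.

Definition tensor_degree b : int := #|circles (st b) :\: minus b|%:Z - #|minus b|%:Z.

Definition bidegree b : int * int :=
  (#|st b|%:Z - (n_neg D)%:Z,
   tensor_degree b + #|st b|%:Z + (n_pos D)%:Z - 2 * (n_neg D)%:Z).

Definition CKh : vectType rat := {ffun enhanced_state -> rat^o}.

Definition matrix_fun (a : enhanced_state -> enhanced_state -> rat) (f : CKh) :
  CKh := [ffun b' => \sum_b a b b' * (f : {ffun enhanced_state -> rat^o}) b].

Fact matrix_fun_linear a : linear (matrix_fun a).
Proof.
move=> k f g; apply/ffunP => b'; rewrite !ffunE scaler_sumr -big_split /=.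
by apply: eq_bigr => b _; rewrite !ffunE mulrDr; congr (_ + _); exact: mulrCA.
Qed.
HB.instance Definition _ a :=
  GRing.isLinear.Build rat CKh CKh _ (matrix_fun a) (matrix_fun_linear a).

(* a b b' is the coefficient of b' in the image of b                          *)
Definition of_matrix (a : enhanced_state -> enhanced_state -> rat) : 'End(CKh) :=
  linfun (matrix_fun a).

Definition below (c c' : crossing D) : bool :=
  (enum_rank c < enum_rank c')%N.

(* The coefficient of the merge or split map.  The circles of st b which are  *)
(* not circles of st b' are replaced by those of st b' which are not circles  *)
(* of st b.  With k and k' the numbers of v_- on the former and on the latter *)
(* the multiplication v_+v_+ = v_+, v_+v_- = v_-v_+ = v_-, v_-v_- = 0 has     *)
(* coefficient 1 iff k' = k, and the comultiplication                         *)
(* v_+ |-> v_+ (x) v_- + v_- (x) v_+, v_- |-> v_- (x) v_- iff k' = k + 1.     *)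
Definition edge_map b b' : bool :=
  let old := circles (st b) :\: circles (st b') in
  let new := circles (st b') :\: circles (st b) in
  let k := #|minus b :&: old| in
  let k' := #|minus b' :&: new| in
  (minus b :&: circles (st b') == minus b' :&: circles (st b))
  && [|| [&& #|old| == 2, #|new| == 1 & k' == k]
       | [&& #|old| == 1, #|new| == 2 & k' == k.+1]]%N.

Definition diff_coef b b' : rat :=
  \sum_(c | (c \notin st b) && (st b' == c |: st b))
    (-1) ^+ #|[set c' in st b | below c' c]| * (edge_map b b')%:R.

Definition diff : 'End(CKh) := of_matrix diff_coef.

Section Action.
Variable rho : symmetry D.

Definition turn_state (s : state) : state := turn_crossing rho @: s.

Definition turn_piece (x : piece) : piece :=
  match x with
  | inl e => inl (turn_dart rho e)
  | inr l => inr (turn_loop rho l)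
  end.

Definition inversions (s : state) : nat :=
  #|[set x : crossing D * crossing D | [&& x.1 \in s, x.2 \in s, below x.1 x.2
      & below (turn_crossing rho x.2) (turn_crossing rho x.1)]]|.

Definition turn_coef b b' : rat :=
  (-1) ^+ inversions (st b) *
  ((st b' == turn_state (st b))
   && (minus b' == [set turn_piece @: C | C : {set piece} in minus b]))%:R.

Definition turn : 'End(CKh) := of_matrix turn_coef.

End Action.

Definition homogeneous (ij : int * int) : 'End(CKh) :=
  of_matrix (fun b b' => ((b' == b) && (bidegree b == ij))%:R).

End KhovanovComplex.

(******************************************************************************)
(*                        Equivariant Jones polynomials                       *)
(******************************************************************************)

Section EquivariantHomology.
Variables (d : nat) (D : link_diagram) (rho : symmetry D).

Local Notation H := (homK (Qxi d) (CKh D)).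

(* Hom_{Q[Z/N]}(Q[xi_d], CKh^{i,j}): the maps f with f (xi_d * x) = rho (f x) *)
(* whose values are homogeneous of bidegree (i, j).  It does not depend on N, *)
(* as the generator rho determines the action.                                *)
Definition equivariant_chains (i j : int) : {vspace H} :=
  (lker (post (Qxi d) (turn rho) - xi d *: \1%VF) :&:
   limg (post (Qxi d) (homogeneous D (i, j))))%VS.

Definition equivariant_diff : 'End(H) := post (Qxi d) (diff D).

(* The dimension over Q[xi_d] of Kh^{i,j,d}, the quotient of the cycles by    *)
(* the boundaries                                                             *)
Definition equivariant_betti (i j : int) : int :=
  (\dim (equivariant_chains i j :&: lker equivariant_diff))%:Z
  - (\dim (equivariant_diff @: equivariant_chains (i - 1) j))%:Z.

(* Laurent polynomials are viewed in the field of rational functions in q.    *)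
Definition q : {fraction {poly int}} := tofrac 'X.

(* The sum is over the bidegrees in which the Khovanov complex is nonzero.    *)
Definition equivariant_jones : {fraction {poly int}} :=
  \sum_(ij <- undup (codom (@bidegree D)))
    (-1) ^ ij.1 * q ^ ij.2 * (equivariant_betti ij.1 ij.2)%:~R.

End EquivariantHomology.

(* DJ_{v,u}, for rho of order p ^ v                                           *)
Definition difference_jones (p v u : nat) (D : link_diagram) (rho : symmetry D) :
  {fraction {poly int}} :=
  equivariant_jones (p ^ u) rho
  - (if (u < v)%N then equivariant_jones (p ^ u.+1) rho else 0).

(******************************************************************************)
(*                      States as crossingless diagrams                       *)
(******************************************************************************)

Section States.
Variable D : link_diagram.

Definition circle (s : state D) : finType :=
  {C : {set piece D} | C \in circles s}.

Definition void_opp (e : void * 'Z_4) : void * 'Z_4 := e.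

Fact void_oppK : involutive void_opp. Proof. by []. Qed.

Fact void_opp_outgoing (e : void * 'Z_4) :
  outgoing (fun=> true) (void_opp e) = ~~ outgoing (fun=> true) e.
Proof. by case: e => - []. Qed.

Definition state_diagram (s : state D) : link_diagram :=
  @LinkDiagram void (circle s) void_opp (fun=> true) void_oppK void_opp_outgoing.

Variable rho : symmetry D.

(* When rho ^ k fixes s, it permutes the circles of s and the default value C *)
(* is not used, see [turn_circleE].                                           *)
Definition turn_circle (s : state D) (k : nat) (C : circle s) : circle s :=
  insubd C (iter k (turn_piece rho) @: val C).

Section TurnCircle.
Hypothesis opp_turn : forall e, opp (turn_dart rho e) = turn_dart rho (opp e).
Hypothesis turn_crossing_inj : injective (turn_crossing rho).
Hypothesis turn_loop_inj : injective (turn_loop rho).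

Let turn_dart_inj : injective (turn_dart rho).
Proof. by move=> [c i] [c' i'] [/turn_crossing_inj-> ->]. Qed.

Let turn_piece_inj : injective (turn_piece rho).
Proof.
move=> [e|l] [e'|l'] // eq_t; congr (_ _).
  by apply: turn_dart_inj; move: eq_t => /= [eq1 eq2]; congr (_, _).
by apply: turn_loop_inj; move: eq_t => [].
Qed.

Fact linked_turn (s : state D) x y :
  linked (turn_state rho s) (turn_piece rho x) (turn_piece rho y) = linked s x y.
Proof.
case: x y => [e|l] [e'|l'] //=; rewrite opp_turn (inj_eq turn_dart_inj).
have -> : smooth (turn_state rho s) (turn_dart rho e) = turn_dart rho (smooth s e).
  by rewrite /smooth /turn_dart /= mem_imset.
by rewrite (inj_eq turn_dart_inj).
Qed.

Fact connect_turn (s : state D) x y :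
  connect (linked (turn_state rho s)) (turn_piece rho x) (turn_piece rho y) =
  connect (linked s) x y.
Proof.
pose g := invF turn_piece_inj; have gK := f_invF turn_piece_inj.
apply/idP/idP => /connectP[t]; last first.
  move=> xt ->; apply/connectP; exists [seq turn_piece rho z | z <- t].
      rewrite (map_path (e' := linked s) (b := pred0)) //.
      by move=> z z' _; rewrite linked_turn.
    by rewrite (eq_has (a2 := pred0)) ?has_pred0.
  by rewrite last_map.
move=> xt yE; apply/connectP; exists [seq g z | z <- t]; last first.
  by apply: turn_piece_inj; rewrite -last_map -map_comp (eq_map gK) map_id.
rewrite -[x](invF_f turn_piece_inj) -/g.
rewrite (map_path (e' := linked (turn_state rho s)) (b := pred0)) //.
  by move=> z z' _ /=; rewrite -linked_turn /g !f_invF.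
by rewrite (eq_has (a2 := pred0)) ?has_pred0.
Qed.

Fact circles_turn (s : state D) (C : {set piece D}) :
  C \in circles s -> turn_piece rho @: C \in circles (turn_state rho s).
Proof.
case/imsetP=> x _ ->; apply/imsetP; exists (turn_piece rho x) => //.
apply/setP => y; rewrite -[y](f_invF turn_piece_inj) mem_imset // !inE.
by rewrite connect_turn.
Qed.

Lemma turn_circleE (s : state D) (k : nat) (C : circle s) :
  iter k (turn_state rho) s = s ->
  val (turn_circle k C) = iter k (turn_piece rho) @: val C.
Proof.
move=> fix_s; rewrite val_insubd ifT //; move: (val C) (valP C) => {}C inC.
rewrite -{}fix_s; elim: k => [|k IHk] /=; first by rewrite imset_id.
by rewrite (imset_comp (turn_piece rho)) circles_turn.
Qed.
End TurnCircle.

Definition state_symmetry (s : state D) (k : nat) : symmetry (state_diagram s) :=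
  @Symmetry (state_diagram s) id (turn_circle k).

(* S^{p ^ v}(D): the states whose stabilizer in Z/p^n, i.e. among the powers  *)
(* rho ^ k with k < p ^ n, has order p ^ v                                    *)
Definition symmetric_states (p n v : nat) : {set state D} :=
  [set s | #|[set k : 'I_(p ^ n) | iter k (turn_state rho) s == s]| == p ^ v]%N.

(* One state from each orbit of Z/p^n on S^{p ^ v}(D).  The complex is the    *)
(* direct sum over orbits of states of the modules induced from stabilizers,  *)
(* so an orbit, and not each of its p ^ (n - v) members, contributes once.    *)
Definition symmetric_state_reps (p n v : nat) : {set state D} :=
  [set s in symmetric_states p n v | froots (turn_state rho) s].

End States.

(* Main.v *)
(* The Euler characteristic of the equivariant homology is that of the         *)
(* equivariant chains, because the boundaries cancel in adjacent degrees.  On  *)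
(* the chains a generator acts as a signed permutation of the enhanced states; *)
(* its order is odd, so the product of the signs along each orbit is 1, and an *)
(* orbit of size l contributes Q[Z/l], in which xi_d occurs iff d divides l.   *)
(* Hence DJ_{n,n-m}(D) counts, with weight (-1)^i q^j, the orbits of enhanced  *)
(* states of size exactly p^(n-m).  An enhanced state over a state s with      *)
(* stabilizer of order p^v has an orbit of that size iff its orbit under the   *)
(* stabilizer has size p^(v-m), and those orbits are counted by DJ_{v,v-m}(s). *)

From HB Require Import structures.
Require Import Defs.
From mathcomp Require Import all_boot all_order all_algebra all_field.
From mathcomp Require Import zify.

Set Implicit Arguments.
Unset Strict Implicit.
Unset Printing Implicit Defensive.

Import GRing.Theory.
Local Open Scope ring_scope.

(** * Orbits of permutations *)

(** The rotation permutes enhanced states up to sign, so the problem becomes one of counting orbits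
    of [turn_enhanced]. Rank-nullity replaces homology by chains ([equivariant_jones_Euler]). An
    equivariant chain is determined on each orbit by one value, subject to a closing condition
    ([dim_twisted_functions]): on an orbit of length l, the product of the signs times xi_d^(-l)
    must be 1. The signs multiply to 1 because the period is odd ([orbit_sign]), so the condition is
    d | l, and [equivariant_jones_orbits] counts orbits of length divisible by d. All lengths are
    powers of p, hence DJ_{n,n-m} counts those of length exactly p^(n-m); multiplied by that length
    it becomes a sum over enhanced states, free of any choice of representatives
    ([difference_jones_orbits]).

    This sum is grouped by the underlying state s. If s has orbit length p^(n-v), its stabilizer is
    generated by the p^(n-v)-th power of the rotation, and an enhanced state over s has orbit length
    p^(n-m) iff its length under that generator is p^(v-m). Enhanced states over s are those of s as
    a crossingless diagram, so they yield p^(v-m) DJ_{v,v-m}(s) ([difference_jones_state]). The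
    p^(n-v) states in the orbit of s contribute equally, which supplies the missing factor, and
    p^(n-m) cancels ([mulrn_fraction_inj]). *)

Section Orbits.
Variables (T : finType) (f : T -> T).
Hypothesis f_inj : injective f.

Lemma iter_eq_order k x : (iter k f x == x) = (order f x %| k)%N.
Proof.
have iterM j : iter (j * order f x) f x = x.
  by elim: j => // j IHj; rewrite mulSn iterD IHj iter_order.
rewrite {1}(divn_eq k (order f x)) addnC iterD iterM /dvdn.
have /findex_iter lt_r : (k %% order f x < order f x)%N.
  by rewrite ltn_mod order_gt0.
apply/eqP/eqP => [fix_r|->] //; by rewrite -lt_r fix_r findex0.
Qed.

Lemma froot_iterP x :
  exists2 k, (k < order f (froot f x))%N & x = iter k f (froot f x).
Proof.
have cx : fconnect f (froot f x) x by rewrite fconnect_sym ?connect_root.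
by exists (findex f (froot f x) x); rewrite ?findex_max ?iter_findex.
Qed.

Lemma froot_f x : froot f (f x) = froot f x.
Proof.
have symf := fconnect_sym f_inj.
by apply/eqP; rewrite (root_connect symf) symf fconnect1.
Qed.

Lemma invariant_froot (R : Type) (w : T -> R) x :
  (forall y, w (f y) = w y) -> w (froot f x) = w x.
Proof.
move=> wf; have [k _ {2}->] := froot_iterP x.
by elim: k => //= k IHk; rewrite wf.
Qed.

Lemma sum_froots (R : nmodType) (P : pred T) (w : T -> R) :
    (forall x, P (f x) = P x) -> (forall x, w (f x) = w x) ->
  \sum_(x | P x) w x = \sum_(r | froots f r && P r) w r *+ order f r.
Proof.
move=> Pf wf; have symf := fconnect_sym f_inj.
rewrite (partition_big (froot f) (fun r => froots f r && P r)) /=.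
  apply: eq_bigr => r /andP[/eqP rr Pr].
  rewrite (eq_bigr (fun=> w r)) => [|x /andP[_ /eqP<-]]; last first.
    by rewrite invariant_froot.
  rewrite sumr_const; congr (_ *+ _); apply: eq_card => x.
  rewrite unfold_in -[RHS]/(fconnect f r x) -(root_connect symf) rr [RHS]eq_sym /=.
  by rewrite andb_idl // => /eqP rx; rewrite -(invariant_froot x Pf) rx.
by move=> x Px; rewrite (invariant_froot x Pf) Px andbT (roots_root symf).
Qed.

End Orbits.

Lemma eq_order_semiconj (T T' : finType) (f : T -> T) (g : T' -> T')
    (h : T -> T') (x : T) :
    injective f -> injective g -> injective h ->
    (forall y, h (f y) = g (h y)) ->
  order g (h x) = order f x.
Proof.
move=> f_inj g_inj h_inj hf.
have hk k : h (iter k f x) = iter k g (h x) by elim: k => //= k <-; rewrite hf.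
by apply/eqP; rewrite eqn_dvd -!iter_eq_order // -hk iter_order // eqxx /=
  -(inj_eq h_inj) hk iter_order // eqxx.
Qed.

Lemma order_f (T : finType) (f : T -> T) (x : T) :
  injective f -> order f (f x) = order f x.
Proof. by move=> f_inj; apply: eq_order_semiconj. Qed.

(** * Functions multiplied by prescribed scalars along orbits *)

Section TwistedFunctions.
Variables (T : finType) (f : T -> T).
Hypothesis f_inj : injective f.
Variables (K : fieldType) (H L : vectType K) (ev : T -> 'Hom(H, L)).
Hypothesis ev_inj : forall h, (forall x, ev x h = 0) -> h = 0.
Hypothesis ev_surj : forall g : T -> L, exists h, forall x, ev x h = g x.

(** [ev] identifies [H] with the functions from [T] to [L]. The value at the root of an orbit
    determines the others, and going round once multiplies it by the product of [c] along the orbit.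
    It is free when that product is 1 and forced to be 0 otherwise; zero values of [c] are
    allowed. *)
Lemma dim_twisted_functions (c : T -> K) (W : {vspace H}) :
    (forall h, h \in W <-> forall x, ev (f x) h = c x *: ev x h) ->
  \dim W = (#|[set r | froots f r
                      & (\prod_(i < order f r) c (iter i f r) == 1)%R]|
            * \dim {:L})%N.
Proof.
move=> WP; pose trans k r := \prod_(i < k) c (iter i f r).
set I := [set r | _ & _].
have transS k r : trans k.+1 r = c (iter k f r) * trans k r.
  by rewrite /trans big_ord_recr mulrC.
have ev_iter h r k : h \in W -> ev (iter k f r) h = trans k r *: ev r h.
  move=> /WP hW; elim: k => [|k IHk]; first by rewrite /trans big_ord0 scale1r.
  by rewrite iterS hW IHk transS scalerA.
pose J : finType := {r | r \in I}.
pose Ev_fun (h : H) : {ffun J -> L} := [ffun r => ev (val r) h].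
have Ev_lin : linear Ev_fun.
  by move=> a h h'; apply/ffunP => r; rewrite !ffunE linearP.
pose Ev := linfun (HB.pack_for {linear H -> {ffun J -> L}} Ev_fun
  (GRing.isLinear.Build K H _ _ Ev_fun Ev_lin)).
have EvE h r : Ev h r = ev (val r) h by rewrite lfunE /= ffunE.
rewrite -(limg_dim_eq (f := Ev)); last first.
  apply/eqP; rewrite -subv0; apply/subvP => h.
  rewrite memv_cap memv_ker memv0 => /andP[hW /eqP Eh].
  apply/eqP/ev_inj => x; have [k _ ->] := froot_iterP f_inj x.
  rewrite (ev_iter _ _ _ hW); set r := froot f x.
  have [rI|] := boolP (r \in I).
    by rewrite -(EvE h (Sub r rI)) Eh ffunE scaler0.
  rewrite inE (roots_root (fconnect_sym f_inj)) /= => hol.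
  suff -> : ev r h = 0 by rewrite scaler0.
  have := ev_iter h r (order f r) hW; rewrite iter_order //.
  rewrite -{1}[ev r h]scale1r => /eqP; rewrite -subr_eq0 -scalerBl scaler_eq0.
  by rewrite subr_eq0 eq_sym (negPf hol) => /eqP.
have -> : (Ev @: W = fullv)%VS.
  apply/eqP; rewrite eqEsubv subvf; apply/subvP => g _; apply/memv_imgP.
  (* Prescribed root values, extended by 0 to the roots outside [I], are spread over each orbit by
     [trans]. *)
  pose g' r : L := oapp g 0 (insub r : option J).
  have [h hE] := ev_surj (fun x => trans (findex f (froot f x) x) (froot f x)
                                   *: g' (froot f x)).
  exists h; last first.
    apply/ffunP => r; rewrite EvE hE.
    have /eqP -> : froots f (val r) by have := valP r; rewrite inE => /andP[].
    by rewrite findex0 /trans big_ord0 scale1r /g' valK.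
  apply/WP => x; rewrite !hE froot_f //.
  have [] := froot_iterP f_inj x; set r := froot f x => k lt_k ->.
  rewrite findex_iter // -iterS scalerA -transS.
  have [lt_k1|ge_k] := ltnP k.+1 (order f r); first by rewrite findex_iter.
  (* At the last point the orbit closes up at its root: either the full product is 1 or the root
     value is 0. *)
  have <- : order f r = k.+1 by apply/eqP; rewrite eqn_leq ge_k lt_k.
  rewrite iter_order // findex0 {1}/trans big_ord0 scale1r.
  rewrite /g'; case: insubP => [u uI ur|]; last by rewrite scaler0.
  by move: uI; rewrite inE => /andP[_ /eqP hol]; rewrite /trans hol scale1r.
by rewrite !dimvf; congr (_ * _)%N; rewrite /= card_sig; apply: eq_card.
Qed.

End TwistedFunctions.

(** * Euler characteristics *)

Lemma of_matrixE (D : link_diagram) (a : enhanced_state D -> enhanced_state D -> rat)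
    (f : CKh D) b' :
  (of_matrix a f : {ffun _ -> rat^o}) b' =
  \sum_b a b b' * (f : {ffun enhanced_state D -> rat^o}) b.
Proof. by rewrite lfunE /= ffunE. Qed.

(** * Coordinates on the space of chains *)

Section HomCoordinates.
Variables (K : fieldExtType rat) (D : link_diagram).

Definition value (h : homK K (CKh D)) (x : K) (b : enhanced_state D) : rat :=
  ((h : 'Hom(K, CKh D)) x : {ffun enhanced_state D -> rat^o}) b.

Lemma eq_value h h' : (forall x b, value h x b = value h' x b) -> h = h'.
Proof. by move=> eqv; apply/lfunP => x; apply/ffunP => b; apply: eqv. Qed.

Lemma value0 x b : value 0 x b = 0.
Proof. by rewrite /value zero_lfunE ffunE. Qed.

Lemma value_post a h x b' :
  value (post K (of_matrix a) h) x b' = \sum_b a b b' * value h x b.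
Proof. by rewrite /value /post lfunE /= comp_lfunE of_matrixE. Qed.

Lemma valueZ (a : K) h x b : value (a *: h) x b = value h (a * x) b.
Proof. by rewrite /value homKZE. Qed.

Lemma homogeneousP ij h :
  reflect (forall x b, bidegree b != ij -> value h x b = 0)
          (h \in limg (post K (homogeneous D ij))).
Proof.
have hom_value h' x b : value (post K (homogeneous D ij) h') x b =
    (bidegree b == ij)%:R * value h' x b.
  rewrite value_post (bigD1 b) //= eqxx big1 ?addr0 // => b' neq.
  by rewrite eq_sym (negPf neq) mul0r.
apply: (iffP memv_imgP) => [[h' _ ->] x b neq|h0].
  by rewrite hom_value (negPf neq) mul0r.
exists h; rewrite ?memvf //; apply: eq_value => x b; rewrite hom_value.
by case: eqP => [_|/eqP/h0->]; rewrite ?mul1r ?mulr0.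
Qed.

Definition coordinate_fun b (h : homK K (CKh D)) (x : K) : rat^o := value h x b.

Fact coordinate_fun_linear b h : linear (coordinate_fun b h).
Proof. by move=> a x y; rewrite /coordinate_fun /value linearP !ffunE. Qed.
HB.instance Definition _ b h :=
  GRing.isLinear.Build rat K rat^o _ (coordinate_fun b h) (coordinate_fun_linear b h).

(** Taking values in Hom(K, Q), which has dimension 1 over [K], makes a coordinate [K]-linear, so
    that chains become functions on enhanced states. *)
Definition coordinate b (h : homK K (CKh D)) : homK K rat^o :=
  linfun (coordinate_fun b h).

Lemma coordinateE b h x : (coordinate b h : 'Hom(K, rat^o)) x = value h x b.
Proof. by rewrite lfunE. Qed.

Fact coordinate_linear b : linear (coordinate b).
Proof.
move=> a h h'; apply/lfunP => x.
by rewrite [RHS]add_lfunE homKZE !coordinateE /value add_lfunE ffunE homKZE.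
Qed.
HB.instance Definition _ b :=
  GRing.isLinear.Build K (homK K (CKh D)) (homK K rat^o) _ (coordinate b)
    (coordinate_linear b).

End HomCoordinates.

Lemma dim_homK (K : fieldExtType rat) (V : vectType rat) :
  \dim {:homK K V} = \dim {:V}.
Proof. by rewrite dimvf. Qed.


(** * Cancellation of boundaries in the Euler characteristic *)

Section Euler.
Variables (d : nat) (D : link_diagram) (rho : symmetry D).
Implicit Types b : enhanced_state D.

(** The degree is the number of circles minus twice the number of v_-. A merge loses a circle and
    keeps the number of v_-; a split gains one circle and one v_-. *)
Lemma edge_map_degree b b' :
  edge_map b b' -> tensor_degree b' = tensor_degree b - 1.
Proof.
rewrite /edge_map /tensor_degree => /andP[/eqP same sizes].
have sub0 : minus b \subset circles (st b) := valP b.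
have sub1 : minus b' \subset circles (st b') := valP b'.
rewrite !cardsD (setIidPr sub0) (setIidPr sub1).
have le0 := subset_leq_card sub0; have le1 := subset_leq_card sub1.
have cardD (A B M : {set {set piece D}}) : M \subset A ->
    #|M| = (#|M :&: (A :\: B)| + #|M :&: B|)%N.
  move=> MA; rewrite -(cardsID B M) addnC; congr (#|pred_of_set _| + _)%N.
  by rewrite setIDA (setIidPl MA).
have m0 := cardD _ (circles (st b')) _ sub0.
have m1 := cardD _ (circles (st b)) _ sub1.
have c0 := cardsID (circles (st b')) (circles (st b)).
have c1 := cardsID (circles (st b)) (circles (st b')).
rewrite setIC in c1; move: m0 m1 c0 c1 le0 le1; rewrite same.
by move=> m0 m1 c0 c1 le0 le1; case/orP: sizes => /and3P[/eqP e1 /eqP e2 /eqP e3]; lia.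
Qed.

Lemma diff_coef_bidegree b b' : diff_coef b b' != 0 ->
  bidegree b' = ((bidegree b).1 + 1, (bidegree b).2).
Proof.
rewrite /diff_coef => nz.
have /existsP[c /andP[/andP[cb /eqP stb'] nzc]] : [exists c,
    (c \notin st b) && (st b' == c |: st b) && edge_map b b'].
  apply: contraNT nz => /existsPn none; apply/eqP; apply: big1 => c /andP[c1 c2].
  by have := none c; rewrite c1 c2 /= => /negPf->; rewrite mulr0.
rewrite /bidegree (edge_map_degree nzc) stb' cardsU1 cb /=.
by congr (_, _); lia.
Qed.

Let chains := equivariant_chains d rho.
Let ediff := equivariant_diff d D.

Lemma chains_out i j : (i, j) \notin codom (@bidegree D) -> chains i j = 0%VS.
Proof.
move=> out; apply/eqP; rewrite -subv0; apply/subvP => h.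
rewrite memv_cap memv0 => /andP[_ /homogeneousP h0]; apply/eqP/eq_value => x b.
by rewrite h0 ?value0 //; apply: contraNneq out => <-; rewrite codom_f.
Qed.

Lemma diff_chains_out i j :
  (i + 1, j) \notin codom (@bidegree D) -> (ediff @: chains i j = 0)%VS.
Proof.
move=> out; apply/eqP; rewrite -subv0; apply/subvP => _ /memv_imgP[h hC ->].
move: hC; rewrite memv_cap memv0 => /andP[_ /homogeneousP h0].
apply/eqP/eq_value => x b'; rewrite value0 value_post big1 // => b _.
have [/h0->|] := boolP (bidegree b != (i, j)); first by rewrite mulr0.
rewrite negbK => /eqP bij; have [->|/diff_coef_bidegree] := eqVneq (diff_coef b b') 0.
  by rewrite mul0r.
by rewrite bij => b'ij; rewrite -b'ij codom_f in out.
Qed.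

(** By rank-nullity the rank of each differential enters the alternating sum twice, at its source
    and at its target, with opposite signs. *)
Lemma equivariant_jones_Euler : equivariant_jones d rho =
  \sum_(ij <- undup (codom (@bidegree D)))
    (-1) ^ ij.1 * q ^ ij.2 * (\dim (chains ij.1 ij.2))%:R.
Proof.
rewrite /equivariant_jones; set S := undup _.
have SE ij : (ij \in S) = (ij \in codom (@bidegree D)) by rewrite mem_undup.
(* [g ij] is the signed rank of the differential leaving [ij]. It vanishes unless source and target
   both occur, so the two sums of [g] run over the same arrows. *)
pose g (ij : int * int) : {fraction {poly int}} :=
  (-1) ^ ij.1 * q ^ ij.2 * (\dim (ediff @: chains ij.1 ij.2)%VS)%:R.
pose up (ij : int * int) := (ij.1 + 1, ij.2).
pose down (ij : int * int) := (ij.1 - 1, ij.2).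
have upK : cancel up down by case=> i j; rewrite /down /up /= addrK.
have downK : cancel down up by case=> i j; rewrite /down /up /= subrK.
have g0 ij : ~~ ((ij \in S) && (up ij \in S)) -> g ij = 0.
  rewrite negb_and !SE /g; case: ij => i j /=.
  case/orP => [/chains_out|/diff_chains_out] -> //; last by rewrite dimv0 mulr0.
  by rewrite limg0 dimv0 mulr0.
transitivity (\sum_(ij <- S)
    ((-1) ^ ij.1 * q ^ ij.2 * (\dim (chains ij.1 ij.2))%:R - g ij + g (down ij))).
  apply: eq_bigr => -[i j] _ /=; rewrite /equivariant_betti /g /=.
  rewrite -(limg_ker_dim ediff (chains i j)) natrD rmorphB /= -!pmulrn.
  rewrite expfzDr ?oppr_eq0 ?oner_eq0 // exprN1 invrN1.
  rewrite !mulrDr addrK -mulrA; congr (_ + _).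
  by rewrite mulrN1 !mulNr mulrN.
rewrite big_split /= sumrB -[RHS]addr0 -addrA; congr (_ + _).
rewrite addrC; apply/eqP; rewrite subr_eq0; apply/eqP.
pose both := [seq ij <- S | up ij \in S].
transitivity (\sum_(ij <- both) g ij); last first.
  rewrite /both big_filter big_mkcond big_seq [RHS]big_seq; apply: eq_bigr => ij ijS.
  by case: ifP => // upS; rewrite g0 // upS andbF.
transitivity (\sum_(ij <- [seq ij <- S | down ij \in S]) g (down ij)).
  rewrite big_filter [RHS]big_mkcond big_seq [RHS]big_seq; apply: eq_bigr => ij ijS.
  by case: ifP => // downS; rewrite g0 // downS.
rewrite -(big_map down xpredT g); apply: perm_big.
apply: uniq_perm; rewrite ?filter_uniq ?undup_uniq //.
  by rewrite (map_inj_uniq (can_inj downK)) filter_uniq ?undup_uniq.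
move=> ij; rewrite mem_filter; apply/mapP/andP => [[ij' + ->]|[upS ijS]].
  by rewrite mem_filter downK => /andP[].
by exists (up ij); rewrite ?upK // mem_filter upK ijS.
Qed.

End Euler.

(** * The action on enhanced states *)

Section InversionParity.
Variable T : finType.
Implicit Types (f g : T -> T) (s : {set T}).

Definition rank_lt (x y : T) : bool := (enum_rank x < enum_rank y)%N.

Definition inversion_count f s : nat :=
  #|[set x : T * T | [&& x.1 \in s, x.2 \in s, rank_lt x.1 x.2
      & rank_lt (f x.2) (f x.1)]]|.

Let rank_ltN x y : x != y -> rank_lt y x = ~~ rank_lt x y.
Proof.
move=> neq; rewrite /rank_lt -leqNgt ltn_neqAle andb_idl // => _.
by rewrite (inj_eq val_inj) (inj_eq enum_rank_inj) eq_sym.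
Qed.

Let card_split (P Q : pred (T * T)) :
  #|[set x | P x]| = (#|[set x | P x && Q x]| + #|[set x | P x && ~~ Q x]|)%N.
Proof.
rewrite -(cardsID [set x | Q x]); congr (_ + _)%N; apply: eq_card => x.
  by rewrite !inE.
by rewrite !inE andbC.
Qed.

(** A pair is inverted by the composite iff exactly one of the two steps inverts it. *)
Lemma odd_inversion_comp f g s : injective f -> injective g ->
  odd (inversion_count (g \o f) s) =
  odd (inversion_count f s) (+) odd (inversion_count g (f @: s)).
Proof.
move=> f_inj g_inj.
(* a, b and c compare a pair before f, between f and g, and after g; exchanging *)
(* the two elements of the pair negates all three.                              *)
pose off (x : T * T) := [&& x.1 \in s, x.2 \in s & x.1 != x.2].
pose a (x : T * T) := rank_lt x.1 x.2; pose b (x : T * T) := rank_lt (f x.1) (f x.2).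
pose c (x : T * T) := rank_lt (g (f x.1)) (g (f x.2)).
have cntE (h : T -> T) (u : pred (T * T)) (hs : injective h) :
    #|[set x | [&& x.1 \in s, x.2 \in s, u x & rank_lt (h x.2) (h x.1)]]|
    = #|[set x | off x && u x && ~~ rank_lt (h x.1) (h x.2)]|.
  apply: eq_card => -[x y]; rewrite !inE /off /=; have [->|neq] := eqVneq x y.
    by rewrite /rank_lt ltnn !andbF.
  by rewrite rank_ltN ?(inj_eq hs) // andbT -!andbA.
have nf : inversion_count f s = #|[set x | off x && a x && ~~ b x]|.
  exact: (cntE f a).
have ngf : inversion_count (g \o f) s = #|[set x | off x && a x && ~~ c x]|.
  exact: (cntE (g \o f) a (inj_comp g_inj f_inj)).
have ng : inversion_count g (f @: s) = #|[set x | off x && b x && ~~ c x]|.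
  rewrite -(cntE (g \o f) b (inj_comp g_inj f_inj)).
  pose ff (x : T * T) := (f x.1, f x.2).
  have ff_inj : injective ff by move=> [x y] [x' y'] [/f_inj-> /f_inj->].
  rewrite -(card_imset _ ff_inj); apply: eq_card => -[x y]; rewrite inE /=.
  apply/and4P/imsetP => [[/imsetP[x' x's ->] /imsetP[y' y's ->] lt gt]|].
    by exists (x', y'); rewrite ?inE //=; apply/and4P; split.
  by case=> -[x' y'] + [-> ->]; rewrite !inE /= => /and4P[]; split; rewrite ?imset_f.
have swap : #|[set x | off x && b x && ~~ c x && ~~ a x]|
    = #|[set x | off x && a x && ~~ b x && c x]|.
  pose sw (x : T * T) := (x.2, x.1).
  have sw_inj : injective sw by move=> [x y] [x' y'] [-> ->].
  rewrite -(card_imset _ sw_inj); apply: eq_card => -[x y]; rewrite inE /=.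
  transitivity ((y, x) \in [set x | off x && b x && ~~ c x && ~~ a x]).
    by rewrite -[(x, y)]/(sw (y, x)) mem_imset.
  rewrite inE /off /a /b /c /= eq_sym; have [->|neq] := eqVneq x y.
    by rewrite !andbF.
  rewrite (rank_ltN neq) (@rank_ltN (f x)) ?(inj_eq f_inj) //.
  rewrite (@rank_ltN (g (f x))) ?(inj_eq g_inj) ?(inj_eq f_inj) //.
  by rewrite !negbK; case: (_ \in s) => //=; case: (_ \in s) => //=;
    case: rank_lt; case: rank_lt; case: rank_lt.
have e1 := card_split (fun x => off x && a x && ~~ b x) c.
have e2 := card_split (fun x => off x && a x && ~~ c x) b.
have e3 := card_split (fun x => off x && b x && ~~ c x) a.
have e4 : #|[set x | off x && a x && ~~ c x && ~~ b x]|
    = #|[set x | off x && a x && ~~ b x && ~~ c x]|.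
  by apply: eq_card => x; rewrite !inE andbAC.
have e5 : #|[set x | off x && b x && ~~ c x && a x]|
    = #|[set x | off x && a x && ~~ c x && b x]|.
  apply: eq_card => x; rewrite !inE.
  by case: (off _); case: (a _); case: (b _); case: (c _).
(* Each of the three remaining cardinals occurs in exactly two of the three counts. *)
rewrite -oddD nf ng ngf e1 e2 e3 e4 e5 swap.
set u := #|_|; set v := #|_|; set w := #|_|.
by rewrite addnACA !oddD !addbA addbC; case: (odd u); case: (odd v); case: (odd w).
Qed.

Lemma inversion_count_id s : inversion_count id s = 0%N.
Proof.
apply/eqP; rewrite cards_eq0 -subset0; apply/subsetP => x; rewrite inE /rank_lt.
by case/and4P => _ _ lt /(ltn_trans lt); rewrite ltnn.
Qed.

Lemma eq_inversion_count f g s : f =1 g -> inversion_count f s = inversion_count g s.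
Proof. by move=> fg; apply: eq_card => x; rewrite !inE !fg. Qed.

(* An element of odd order cannot reverse the orientation of a stable set,    *)
(* since the parity of inversions is a homomorphism on the stabilizer.        *)
Lemma odd_period_inversions f s l N :
    injective f -> (forall x, iter N f x = x) -> odd N -> (l %| N)%N ->
    iter l f @: s = s ->
  odd (inversion_count (iter l f) s) = false.
Proof.
move=> f_inj fN oddN /dvdnP[k Nk] fix_s.
have it_inj j : injective (iter j f).
  by elim: j => //= j IHj x y /f_inj /IHj.
have mulk j : odd (inversion_count (iter (j * l) f) s)
    = odd j && odd (inversion_count (iter l f) s).
  elim: j => [|j IHj]; first by rewrite (@eq_inversion_count _ id) ?inversion_count_id.
  rewrite (@eq_inversion_count _ (iter (j * l) f \o iter l f)); last first.
    by move=> x; rewrite mulSn addnC iterD.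
  by rewrite odd_inversion_comp // fix_s IHj /=; case: (odd j); rewrite ?addbb ?addbF.
have := mulk k; rewrite -Nk (@eq_inversion_count _ id) // inversion_count_id.
by move: oddN; rewrite Nk oddM => /andP[-> _] /= <-.
Qed.

End InversionParity.

(** * The rotation as a signed permutation of enhanced states *)

Section SignedPermutation.
Variables (D : link_diagram) (rho : symmetry D).
Hypothesis opp_turn : forall e, Defs.opp (turn_dart rho e) = turn_dart rho (Defs.opp e).
Hypothesis turn_crossing_inj : injective (turn_crossing rho).
Hypothesis turn_loop_inj : injective (turn_loop rho).
Implicit Types b : enhanced_state D.

Lemma turn_piece_inj : injective (turn_piece rho).
Proof.
move=> [[c i]|l] [[c' i']|l'] //= [].
  by move=> /turn_crossing_inj-> ->.
by move=> /turn_loop_inj->.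
Qed.

Lemma turn_state_inj : injective (turn_state rho).
Proof. exact: imset_inj. Qed.

Lemma circles_turn_state (s : state D) :
  circles (turn_state rho s) = [set turn_piece rho @: C | C : {set _} in circles s].
Proof.
apply/eqP; rewrite eqEsubset; apply/andP; split; apply/subsetP => C; last first.
  by case/imsetP => C' C's ->; apply: circles_turn.
case/imsetP => y _ ->; pose x := invF turn_piece_inj y.
have xy : turn_piece rho x = y by rewrite f_invF.
apply/imsetP; exists [set z | connect (linked s) x z]; first exact: imset_f.
apply/setP => z; rewrite -[z](f_invF turn_piece_inj) mem_imset;
  last exact: turn_piece_inj.
by rewrite !inE -xy connect_turn.
Qed.

(** The default [b] of [insubd] is never reached under the hypotheses of the section, see
    [val_turn_enhanced]. *)
Definition turn_enhanced b : enhanced_state D :=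
  insubd b (turn_state rho (st b),
            [set turn_piece rho @: C | C : {set piece D} in minus b]).

Lemma val_turn_enhanced b : val (turn_enhanced b) =
  (turn_state rho (st b), [set turn_piece rho @: C | C : {set piece D} in minus b]).
Proof.
rewrite val_insubd ifT //= circles_turn_state; apply: imsetS; exact: (valP b).
Qed.

Lemma st_turn_enhanced b : st (turn_enhanced b) = turn_state rho (st b).
Proof. by rewrite /st val_turn_enhanced. Qed.

Lemma turn_enhanced_inj : injective turn_enhanced.
Proof.
move=> b b' /(congr1 val); rewrite !val_turn_enhanced => -[/turn_state_inj est].
move=> /(imset_inj (imset_inj turn_piece_inj)) emin.
by apply: val_inj; rewrite [val b]surjective_pairing [val b']surjective_pairing;
  congr (_, _).
Qed.

Lemma turn_coefE b b' :
  turn_coef rho b b' = (-1) ^+ inversions rho (st b) * (b' == turn_enhanced b)%:R.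
Proof. by rewrite -(inj_eq val_inj) val_turn_enhanced [val b']surjective_pairing. Qed.

Lemma tensor_degreeE b : tensor_degree b = #|circles (st b)|%:Z - 2 * #|minus b|%:Z.
Proof.
have sub : minus b \subset circles (st b) := valP b.
rewrite /tensor_degree cardsD (setIidPr sub); have := subset_leq_card sub; lia.
Qed.

Lemma tensor_degree_turn b : tensor_degree (turn_enhanced b) = tensor_degree b.
Proof.
have set_inj := imset_inj turn_piece_inj.
rewrite !tensor_degreeE /st /minus val_turn_enhanced /= circles_turn_state.
by rewrite !(card_imset _ set_inj).
Qed.

Lemma bidegree_turn b : bidegree (turn_enhanced b) = bidegree b.
Proof.
by rewrite /bidegree tensor_degree_turn st_turn_enhanced card_imset.
Qed.

Lemma iter_turn_state k (s : state D) :
  iter k (turn_state rho) s = iter k (turn_crossing rho) @: s.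
Proof.
elim: k => [|k IHk]; first by rewrite imset_id.
by rewrite iterS IHk /turn_state -imset_comp.
Qed.

Lemma st_iter_turn k b : st (iter k turn_enhanced b) = iter k (turn_state rho) (st b).
Proof. by elim: k => //= k IHk; rewrite st_turn_enhanced IHk. Qed.

Variable N : nat.
Hypothesis N_odd : odd N.
Hypothesis turn_crossingN : forall c, iter N (turn_crossing rho) c = c.
Hypothesis turn_enhancedN : forall b, iter N turn_enhanced b = b.

(** By [odd_inversion_comp] the signs telescope to the parity of inversions of the iterate that
    closes the orbit. This iterate fixes the state and has odd period, so the parity is even. *)
Lemma orbit_sign (R : pzRingType) b :
  \prod_(i < order turn_enhanced b) (-1) ^+ inversions rho (st (iter i turn_enhanced b))
  = 1 :> R.
Proof.
have sign_iter k : \prod_(i < k) (-1) ^+ inversions rho (st (iter i turn_enhanced b))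
    = (-1) ^+ inversion_count (iter k (turn_crossing rho)) (st b) :> R.
  elim: k => [|k IHk]; first by rewrite big_ord0 inversion_count_id.
  rewrite big_ord_recr IHk /= -[RHS]signr_odd.
  have itk_inj : injective (iter k (turn_crossing rho)).
    by elim: {IHk} k => //= k IHk x y /turn_crossing_inj /IHk.
  rewrite odd_inversion_comp // signr_addb !signr_odd st_iter_turn.
  by rewrite iter_turn_state.
rewrite sign_iter -signr_odd (@odd_period_inversions _ _ _ _ N) //.
  by rewrite -iter_eq_order ?turn_enhancedN //; exact: turn_enhanced_inj.
rewrite -iter_turn_state -st_iter_turn iter_order //; exact: turn_enhanced_inj.
Qed.

(** In coordinates, equivariance says that a step along an orbit multiplies by a sign and by the
    inverse of [xi d]. Around an orbit of length l this gives xi_d^(-l), which is 1 iff d | l. *)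
Lemma dim_equivariant_chains d i j : (0 < d)%N ->
  \dim (equivariant_chains d rho i j) =
  #|[set r | froots turn_enhanced r
           & (bidegree r == (i, j)) && (d %| order turn_enhanced r)%N]|.
Proof.
move=> d_gt0; have sigma_inj := turn_enhanced_inj.
have xi_neq0 : xi d != 0.
  apply: contra_eq_neq (prim_expr_order (xi_prim d_gt0)) => ->.
  by rewrite expr0n gtn_eqF // eq_sym oner_neq0.
(* The zero values of c force the values of h into bidegree (i, j).            *)
pose c b : Qxi d := if bidegree b == (i, j)
  then (-1) ^+ inversions rho (st b) * (xi d)^-1 else 0.
have sign_value (h : homK (Qxi d) (CKh D)) n x b :
    value h ((-1) ^+ n * x) b = (-1) ^+ n * value h x b.
  rewrite -[in RHS]signr_odd -[in LHS]signr_odd; case: odd; rewrite ?mul1r //.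
  by rewrite !mulN1r /value linearN ffunE.
have value_lin0 (h : homK (Qxi d) (CKh D)) b : value h 0 b = 0.
  by rewrite /value linear0 ffunE.
have post_turn (h : homK (Qxi d) (CKh D)) x b :
    value (post _ (turn rho) h) x (turn_enhanced b)
    = (-1) ^+ inversions rho (st b) * value h x b.
  rewrite value_post (bigD1 b) //= turn_coefE eqxx mulr1 big1 ?addr0 // => b' neq.
  by rewrite turn_coefE (inj_eq sigma_inj) eq_sym (negPf neq) mulr0 mul0r.
pose ev b := linfun (@coordinate (Qxi d) D b).
have evE b h x : (ev b h : 'Hom(_, _)) x = value h x b by rewrite lfunE /= coordinateE.
have chainsP h : h \in equivariant_chains d rho i j <->
    forall b, ev (turn_enhanced b) h = c b *: ev b h.
  split=> [|tw].
    rewrite memv_cap memv_ker => /andP[/eqP hker /homogeneousP h0] b.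
    apply/lfunP => x; rewrite homKZE !evE /c.
    have [bij|nbij] := eqVneq; last by rewrite mul0r value_lin0 h0 ?bidegree_turn.
    rewrite -mulrA sign_value -post_turn.
    have /eqP := hker; rewrite add_lfunE opp_lfunE scale_lfunE id_lfunE subr_eq0.
    by move=> /eqP->; rewrite valueZ mulVKf.
  have h0 x b : bidegree b != (i, j) -> value h x b = 0.
    rewrite -[b](f_finv sigma_inj) bidegree_turn => nbij.
    by rewrite -evE tw homKZE evE /c (negPf nbij) mul0r value_lin0.
  rewrite memv_cap memv_ker; apply/andP; split; last by apply/homogeneousP => x b /h0.
  rewrite add_lfunE opp_lfunE scale_lfunE id_lfunE subr_eq0; apply/eqP/eq_value => x b.
  rewrite -[b](f_finv sigma_inj) post_turn valueZ.
  rewrite -(evE (turn_enhanced _)) tw homKZE evE /c.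
  set b' := finv _ _; have [bij|nbij] := eqVneq.
    by rewrite -mulrA mulKf // sign_value.
  by rewrite mul0r value_lin0 h0 ?mulr0.
have ev_surj (g : enhanced_state D -> homK (Qxi d) rat^o) :
    exists h, forall b, ev b h = g b.
  pose h_fun x : CKh D := [ffun b => (g b : 'Hom(Qxi d, rat^o)) x].
  have h_lin : linear h_fun by move=> a x y; apply/ffunP => b; rewrite !ffunE linearP.
  exists (linfun (HB.pack_for {linear Qxi d -> CKh D} h_fun
    (GRing.isLinear.Build rat (Qxi d) _ _ h_fun h_lin))) => b.
  by apply/lfunP => x; rewrite evE /value lfunE /= ffunE.
have ev_inj h : (forall b, ev b h = 0) -> h = 0.
  move=> h0; apply/eq_value => x b.
  by rewrite value0 -evE h0 zero_lfunE.
rewrite (dim_twisted_functions sigma_inj ev_inj ev_surj chainsP).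
rewrite dim_homK dimvf muln1; apply: eq_card => r; rewrite !inE; congr (_ && _).
have bid_iter k : bidegree (iter k turn_enhanced r) = bidegree r.
  by elim: k => //= k IHk; rewrite bidegree_turn.
(* In a wrong bidegree the factor at the root is 0, so the product cannot be 1. *)
have [bij|nbij] := eqVneq (bidegree r) (i, j); last first.
  have := order_gt0 turn_enhanced r; case: order => // k _.
  rewrite big_ord_recl /c /= (negPf nbij) mul0r.
  by rewrite eq_sym oner_eq0.
rewrite (eq_bigr (fun k : 'I__ =>
  (-1) ^+ inversions rho (st (iter k turn_enhanced r)) * (xi d)^-1)); last first.
  by move=> k _; rewrite /c bid_iter bij eqxx.
rewrite big_split /= orbit_sign mul1r prodr_const card_ord.
by rewrite (prim_order_dvd (xi_prim d_gt0)) exprVn invr_eq1.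
Qed.

Definition weight b : {fraction {poly int}} := (-1) ^ (bidegree b).1 * q ^ (bidegree b).2.

Lemma weight_turn b : weight (turn_enhanced b) = weight b.
Proof. by rewrite /weight bidegree_turn. Qed.

Lemma equivariant_jones_orbits d : (0 < d)%N ->
  equivariant_jones d rho =
  \sum_(r | froots turn_enhanced r && (d %| order turn_enhanced r)%N) weight r.
Proof.
move=> d_gt0; rewrite equivariant_jones_Euler.
under eq_bigr => ij _.
  rewrite dim_equivariant_chains // -sum1_card natr_sum mulr_sumr.
  under eq_bigl => r do rewrite inE -surjective_pairing andbCA.
  rewrite big_mkcondl.
  over.
rewrite exchange_big /=; apply: eq_bigr => r _.
rewrite (bigD1_seq (bidegree r)) ?undup_uniq ?mem_undup ?codom_f //= eqxx mulr1.
by rewrite big1 ?addr0 // => ij; rewrite eq_sym => /negPf->.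
Qed.

(** Among powers of p, being divisible by p^u but not by p^(u+1) means being p^u. The factor p^u
    turns the sum over orbits into one over enhanced states, which can be regrouped by state. *)
Lemma difference_jones_orbits p v u : prime p -> (u <= v)%N ->
    (forall b, (order turn_enhanced b %| p ^ v)%N) ->
  difference_jones p v u rho *+ p ^ u =
  \sum_(b | (order turn_enhanced b == p ^ u)%N) weight b.
Proof.
move=> p_pr le_uv ord_dvd; have p_gt1 := prime_gt1 p_pr.
have sigma_inj := turn_enhanced_inj.
rewrite (sum_froots sigma_inj) => [|b|]; [|by rewrite order_f|exact: weight_turn].
transitivity (\sum_(r | froots turn_enhanced r && (order turn_enhanced r == p ^ u)%N)
   weight r *+ p ^ u); last by apply: eq_bigr => r /andP[_ /eqP->].
rewrite sumrMnl; congr (_ *+ _).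
(* The test [u < v] matches the convention at u = v, where p^(u+1) divides no orbit length. *)
have eq_ord r : (order turn_enhanced r == p ^ u)%N =
   (p ^ u %| order turn_enhanced r)%N
   && ~~ ((u < v) && (p ^ u.+1 %| order turn_enhanced r))%N.
  have /(dvdn_pfactor _ _ p_pr)[a le_av ->] := ord_dvd r.
  rewrite !dvdn_Pexp2l // eqn_exp2l //; apply/eqP/andP => [->|[]]; lia.
rewrite /difference_jones !equivariant_jones_orbits ?expn_gt0 ?(ltnW p_gt1) //.
transitivity (\sum_(r | froots turn_enhanced r && (p ^ u %| order turn_enhanced r)%N)
  weight r - \sum_(r | froots turn_enhanced r &&
   ((u < v) && (p ^ u.+1 %| order turn_enhanced r))%N) weight r).
  congr (_ - _); case: ifP => _ //=.
  by rewrite big_pred0 // => r; rewrite andbF.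
apply/eqP; rewrite subr_eq; apply/eqP.
rewrite (bigID (fun r => (u < v)%N && (p ^ u.+1 %| order turn_enhanced r)%N)) /=.
rewrite addrC; congr (_ + _); apply: eq_bigl => r.
  by rewrite eq_ord andbA.
rewrite -andbA; congr (_ && _); apply: andb_idl => /andP[_].
by apply: dvdn_trans; rewrite dvdn_Pexp2l.
Qed.

End SignedPermutation.

(** * Crossingless diagrams of states *)

(** The orbit splits into [k] orbits of [iter k f] of equal length. *)
Lemma order_iter (T : finType) (f : T -> T) (k : nat) x :
  injective f -> (0 < k)%N -> (k %| order f x)%N ->
  order f x = (k * order (iter k f) x)%N.
Proof.
move=> f_inj k_gt0 /dvdnP[j jE].
have it_inj i : injective (iter i f).
  by elim: i => //= i IHi y z /f_inj /IHi.
have iterM i y : iter i (iter k f) y = iter (i * k) f y.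
  by elim: i => //= i ->; rewrite mulSn iterD.
rewrite jE mulnC; congr (_ * _)%N; apply/eqP; rewrite eqn_dvd.
rewrite -[X in _ && X]iter_eq_order // iterM -jE iter_order // eqxx andbT.
rewrite -(dvdn_pmul2r k_gt0) -jE -iter_eq_order // -iterM iter_order //.
Qed.

(** * The stabilizer of a state acting on its circles *)

Section IteratedTurn.
Variables (D : link_diagram) (rho : symmetry D).
Hypothesis opp_turn : forall e, Defs.opp (turn_dart rho e) = turn_dart rho (Defs.opp e).
Hypothesis turn_crossing_inj : injective (turn_crossing rho).
Hypothesis turn_loop_inj : injective (turn_loop rho).

Lemma minus_iter_turn k (b : enhanced_state D) :
  minus (iter k (turn_enhanced rho) b)
  = [set iter k (turn_piece rho) @: C | C : {set piece D} in minus b].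
Proof.
elim: k => [|k IHk].
  by rewrite -[LHS]imset_id; apply: eq_imset => C; rewrite /= imset_id.
rewrite iterS /minus val_turn_enhanced // -/(minus _) IHk -imset_comp.
by apply: eq_imset => C; rewrite /= -imset_comp.
Qed.

Lemma iter_turn_enhanced N (b : enhanced_state D) :
  (forall c, iter N (turn_crossing rho) c = c) ->
  (forall l, iter N (turn_loop rho) l = l) ->
  iter N (turn_enhanced rho) b = b.
Proof.
move=> cN lN.
have pieceN x : iter N (turn_piece rho) x = x.
  have dartE k c i : iter k (turn_piece rho) (inl (c, i))
      = inl (iter k (turn_crossing rho) c, i) by elim: k => //= k ->.
  have loopE k l : iter k (turn_piece rho) (inr l) = inr (iter k (turn_loop rho) l).
    by elim: k => //= k ->.
  by case: x => [[c i]|l]; rewrite ?dartE ?loopE ?cN ?lN.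
apply: val_inj; rewrite [LHS]surjective_pairing [RHS]surjective_pairing.
rewrite -!/(st _) -!/(minus _) st_iter_turn // minus_iter_turn iter_turn_state.
congr (_, _); first by rewrite (eq_imset _ cN) imset_id.
rewrite -[RHS]imset_id; apply: eq_imset => C.
by rewrite (eq_imset _ pieceN) imset_id.
Qed.

Variables (s : state D) (k : nat).
Hypothesis fix_s : iter k (turn_state rho) s = s.

Let tau : circle s -> circle s := turn_circle rho k.
Let rho_s := state_symmetry rho s k.

Let val_tau (C : circle s) : val (tau C) = iter k (turn_piece rho) @: val C.
Proof. exact: turn_circleE. Qed.

Lemma turn_circle_inj : injective tau.
Proof.
have itk_inj : injective (iter k (turn_piece rho)).
  elim: k => //= j IHj x y /turn_piece_inj; move=> H; apply: IHj; exact: H.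
by move=> C C' /(congr1 val); rewrite !val_tau => /(imset_inj itk_inj)/val_inj.
Qed.

Lemma opp_turn_state_diagram e :
  Defs.opp (turn_dart rho_s e) = turn_dart rho_s (Defs.opp e).
Proof. by case: e => - []. Qed.

Lemma turn_crossing_state_diagram_inj : injective (turn_crossing rho_s).
Proof. by case. Qed.

Let single (C : circle s) : {set piece (state_diagram s)} := [set inr C].

Let single_inj : injective single.
Proof. by move=> C C' /set1_inj[]. Qed.

Lemma circles_state_diagram (t : state (state_diagram s)) :
  circles t = single @: setT.
Proof.
have connE C : [set y | connect (linked t) (inr C) y] = single C.
  apply/setP => y; rewrite !inE; apply/idP/eqP => [/connectP[[|z w] /=]|->].
  - by move=> _ ->.
  - by [].
  - exact: connect0.
apply/setP => X; apply/imsetP/imsetP => [[[[[]]|C] _ ->]|[C _ ->]].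
  by exists C; rewrite ?inE ?connE.
by exists (inr C); rewrite ?connE.
Qed.

Fact on_state_diagram_subproof (A : {set circle s}) :
  single @: A \subset circles (set0 : state (state_diagram s)).
Proof. by rewrite circles_state_diagram imsetS // subsetT. Qed.

(** A set [A] of circles carrying v_- is read here on the crossingless diagram, and by [on_state] as
    an enhanced state of [D] over [s]; the two are compared through [A]. *)
Definition on_state_diagram (A : {set circle s}) : enhanced_state (state_diagram s) :=
  exist _ (set0, single @: A) (on_state_diagram_subproof A).

Fact on_state_subproof (A : {set circle s}) : val @: A \subset circles s.
Proof. by apply/subsetP => _ /imsetP[C _ ->]; apply: valP. Qed.

Definition on_state (A : {set circle s}) : enhanced_state D :=
  exist _ (s, val @: A) (on_state_subproof A).

Lemma on_state_diagram_bij : bijective on_state_diagram.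
Proof.
exists (fun x => single @^-1: minus x) => [A|x].
  by apply/setP => C; rewrite inE mem_imset.
apply: val_inj; rewrite [RHS]surjective_pairing; congr (_, _).
  by apply/setP => - [].
apply/setP => X; apply/imsetP/idP => [[C + ->]|Xx]; first by rewrite inE.
have sub : minus x \subset circles (st x) := valP x.
have := subsetP sub X Xx; rewrite circles_state_diagram => /imsetP[C _ XE].
by exists C; rewrite ?inE -?XE.
Qed.

Lemma on_state_inj : injective on_state.
Proof. by move=> A B /(congr1 val)[] /(imset_inj val_inj). Qed.

Lemma on_stateK (b : enhanced_state D) :
  st b = s -> on_state [set C | val C \in minus b] = b.
Proof.
move=> bs; apply: val_inj; apply/esym.
rewrite [LHS]surjective_pairing; congr (_, _) => //.
have sub : minus b \subset circles (st b) := valP b.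
apply/setP => X; apply/idP/imsetP => [Xb|[C + ->]]; last by rewrite inE.
have := subsetP sub X Xb; rewrite bs => Xs.
by exists (Sub X Xs); rewrite ?inE SubK.
Qed.

Lemma on_state_diagram_turn (A : {set circle s}) :
  on_state_diagram (tau @: A) = turn_enhanced rho_s (on_state_diagram A).
Proof.
apply: val_inj; rewrite (val_turn_enhanced opp_turn_state_diagram
  turn_crossing_state_diagram_inj turn_circle_inj) /=.
congr (_, _); first by rewrite /turn_state imset0.
rewrite -[minus _]/(single @: A) -!imset_comp; apply: eq_imset => C /=.
by rewrite /single imset_set1.
Qed.

Lemma on_state_turn (A : {set circle s}) :
  on_state (tau @: A) = iter k (turn_enhanced rho) (on_state A).
Proof.
apply: val_inj; rewrite [RHS]surjective_pairing -/(st _) -/(minus _).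
rewrite st_iter_turn // minus_iter_turn fix_s; congr (_, _).
rewrite -[minus _]/(val @: A) -!imset_comp; apply: eq_imset => C /=.
exact: val_tau.
Qed.

Lemma tensor_degree_on_state A :
  tensor_degree (on_state_diagram A) = tensor_degree (on_state A).
Proof.
rewrite !tensor_degreeE circles_state_diagram -[st (on_state A)]/s.
rewrite -[minus (on_state A)]/(val @: A) -[minus _]/(single @: A).
rewrite !(card_imset _ single_inj) (card_imset _ val_inj).
by rewrite cardsT card_sig.
Qed.

Lemma weight_on_state_diagram A :
  weight (on_state_diagram A) = q ^ tensor_degree (on_state A).
Proof.
have void0 (B : {set void}) : #|B| = 0%N by apply: eq_card0 => - [].
rewrite /weight /bidegree /n_neg /n_pos !void0 tensor_degree_on_state /=.
by rewrite !addr0 mul1r.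
Qed.

Variables (p n v m : nat).
Hypothesis p_prime : prime p.
Hypothesis p_odd : odd p.
Hypothesis le_vn : (v <= n)%N.
Hypothesis le_mv : (m <= v)%N.
Hypothesis turn_crossingN : forall c, iter (p ^ n) (turn_crossing rho) c = c.
Hypothesis turn_loopN : forall l, iter (p ^ n) (turn_loop rho) l = l.
Hypothesis kE : k = (p ^ (n - v))%N.
Hypothesis order_s : order (turn_state rho) s = k.

(** An iterate fixing an enhanced state fixes its state, so an orbit over [s] has length [k] times
    its length under the generator of the stabilizer. With k = p^(n-v), length p^(n-m) corresponds
    to p^(v-m). *)
Lemma difference_jones_state :
  difference_jones p v (v - m) rho_s *+ p ^ (v - m) =
  \sum_(b | (st b == s) && (order (turn_enhanced rho) b == p ^ (n - m))%N)
     q ^ tensor_degree b.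
Proof.
have k_gt0 : (0 < k)%N by rewrite kE expn_gt0 prime_gt0.
have sig_inj : injective (turn_enhanced rho) by apply: turn_enhanced_inj.
have sigs_inj : injective (turn_enhanced rho_s).
  exact: (turn_enhanced_inj opp_turn_state_diagram
    turn_crossing_state_diagram_inj turn_circle_inj).
have itk_inj : injective (iter k (turn_enhanced rho)).
  by elim: (k) => //= j IHj x y /sig_inj /IHj.
have tau_inj := imset_inj turn_circle_inj.
have orderE A : order (turn_enhanced rho) (on_state A)
    = (k * order (turn_enhanced rho_s) (on_state_diagram A))%N.
  rewrite (@order_iter _ _ k) //; last first.
    rewrite -order_s -iter_eq_order; last exact: turn_state_inj.
    by rewrite -[s in X in X == _]/(st (on_state A)) -st_iter_turn ?iter_order.
  congr (_ * _)%N.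
  rewrite (eq_order_semiconj A tau_inj itk_inj on_state_inj on_state_turn).
  rewrite (eq_order_semiconj A tau_inj sigs_inj (bij_inj on_state_diagram_bij)) //.
  exact: on_state_diagram_turn.
(* Cancelling k = p^(n-v) from the period p^n leaves p^v. *)
have ord_dvd x : (order (turn_enhanced rho_s) x %| p ^ v)%N.
  have [g _ gK] := on_state_diagram_bij; rewrite -[x]gK.
  rewrite -(dvdn_pmul2l k_gt0) -orderE -iter_eq_order // kE -expnD subnK //.
  by rewrite iter_turn_enhanced.
have oddN : odd (p ^ v) by rewrite oddX p_odd orbT.
have crossN (c : void) : iter (p ^ v) id c = c by case: c.
have enhN x : iter (p ^ v) (turn_enhanced rho_s) x = x.
  by apply/eqP; rewrite iter_eq_order.
rewrite (difference_jones_orbits opp_turn_state_diagram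
  turn_crossing_state_diagram_inj turn_circle_inj oddN crossN enhN p_prime
  (leq_subr m v) ord_dvd).
rewrite (reindex on_state_diagram) /=; last exact/onW_bij/on_state_diagram_bij.
rewrite [RHS](reindex_onto on_state (fun b => [set C | val C \in minus b])) /=;
  last by move=> b /andP[/eqP /on_stateK].
apply: eq_big => [A|A _]; last exact: weight_on_state_diagram.
rewrite -[st (on_state A)]/s -[minus (on_state A)]/(val @: A) eqxx orderE.
have -> : [set C | val C \in val @: A] == A.
  by apply/eqP/setP => C; rewrite inE (mem_imset _ _ val_inj).
rewrite andbT; have -> : (p ^ (n - m) = k * p ^ (v - m))%N.
  by rewrite kE -expnD; congr (_ ^ _)%N; lia.
by rewrite eqn_pmul2l.
Qed.

End IteratedTurn.

(** * Regrouping the sum over enhanced states by state *)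

Lemma card_multiples_ord N l : (0 < l)%N -> (l %| N)%N ->
  #|[set i : 'I_N | (l %| i)%N]| = (N %/ l)%N.
Proof.
move=> l_gt0 /dvdnP[k ->]; rewrite mulnK //.
have lt_mul (j : 'I_k) : (j * l < k * l)%N by rewrite ltn_pmul2r.
have mul_inj : injective (fun j : 'I_k => Ordinal (lt_mul j)).
  by move=> i j [/eqP]; rewrite eqn_pmul2r // => /eqP/val_inj.
rewrite -[RHS]card_ord -(card_imset predT mul_inj); apply: eq_card => i; rewrite inE.
apply/idP/imsetP => [/dvdnP[j iE]|[j _ ->]]; last exact: dvdn_mull.
have lt_jk : (j < k)%N by rewrite -(ltn_pmul2r l_gt0) -iE.
by exists (Ordinal lt_jk) => //; apply: val_inj.
Qed.

Lemma mulrn_fraction_inj n (x y : {fraction {poly int}}) :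
  (0 < n)%N -> x *+ n = y *+ n -> x = y.
Proof.
move=> n_gt0 /eqP; rewrite -subr_eq0 -mulrnBl -mulr_natr mulf_eq0 subr_eq0.
case/orP => [/eqP //|]; rewrite -(rmorph_nat (@tofrac _)) tofrac_eq0.
by rewrite -polyC_natr polyC_eq0 Num.Theory.pnatr_eq0 gtn_eqF.
Qed.

Lemma q_neq0 : q != 0.
Proof. by rewrite /q tofrac_eq0 polyX_eq0. Qed.

(** Separates the normalisation, which depends on [D] alone, from the contribution of the enhanced
    state. *)
Lemma weightE (D : link_diagram) (b : enhanced_state D) :
  weight b = (-1) ^+ n_neg D * q ^ ((n_pos D)%:Z - 2 * (n_neg D)%:Z)
             * ((- q) ^+ #|st b| * q ^ tensor_degree b).
Proof.
rewrite /weight /bidegree /= -[_ + _ + _ - _]addrA.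
move: (tensor_degree b) (_ - 2 * _) => t e.
have m1_neq0 : -1 != 0 :> {fraction {poly int}} by rewrite oppr_eq0 oner_eq0.
rewrite !(expfzDr _ _ q_neq0) (expfzDr _ _ m1_neq0).
rewrite -invr_expz -!exprnP invr_sign [(- q) ^+ _]exprNn.
rewrite [(-1) ^+ _ * (-1) ^+ _]mulrC [_ * q ^ e]mulrC mulrACA; congr (_ * _).
by rewrite -mulrA; congr (_ * _); rewrite mulrC.
Qed.

Theorem theorem4p1 (p n m : nat) (D : link_diagram) (rho : symmetry D)
    (p_prime : prime p) (p_odd : odd p) (n_gt0 : (0 < n)%N) (le_mn : (m <= n)%N)
    (D_periodic : periodic (p ^ n) rho) :
  difference_jones p n (n - m) rho =
  (-1) ^+ n_neg D * q ^ ((n_pos D)%:Z - 2 * (n_neg D)%:Z) *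
  \sum_(m <= v < n.+1)
    \sum_(s in symmetric_state_reps rho p n v)
      (- q) ^+ #|s| *
      difference_jones p v (v - m) (state_symmetry rho s (p ^ (n - v))).
Proof.
have [opp_turn crossN loopN] : [/\
    forall e, Defs.opp (turn_dart rho e) = turn_dart rho (Defs.opp e),
    forall c, iter (p ^ n) (turn_crossing rho) c = c &
    forall l, iter (p ^ n) (turn_loop rho) l = l].
  by case: D_periodic => R [_ []] [].
have pk_gt0 k : (0 < p ^ k)%N by rewrite expn_gt0 prime_gt0.
have inj_of_iter (T : Type) (f : T -> T) :
    (forall x, iter (p ^ n) f x = x) -> injective f.
  by move=> fN x y fxy; rewrite -[x]fN -[y]fN -(prednK (pk_gt0 n)) !iterSr fxy.
have cross_inj := inj_of_iter _ _ crossN; have loop_inj := inj_of_iter _ _ loopN.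
set sigma := turn_enhanced rho.
have sig_inj : injective sigma := turn_enhanced_inj opp_turn cross_inj loop_inj.
have sigN b : iter (p ^ n) sigma b = b by apply: iter_turn_enhanced.
have st_inj : injective (turn_state rho) := turn_state_inj cross_inj.
have stN s : iter (p ^ n) (turn_state rho) s = s.
  by rewrite iter_turn_state (eq_imset _ crossN) imset_id.
have st_turn b : st (sigma b) = turn_state rho (st b) by apply: st_turn_enhanced.
have oddN : odd (p ^ n) by rewrite oddX p_odd orbT.
have ord_dvd b : (order sigma b %| p ^ n)%N by rewrite -iter_eq_order // sigN.
(* The powers fixing [s] are the multiples of its orbit length, so a stabilizer of order p^v means
   an orbit of length p^(n-v). *)
have symE v s : (v <= n)%N -> (s \in symmetric_states rho p n v)
    = (order (turn_state rho) s == p ^ (n - v))%N.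
  move=> le_vn; rewrite inE.
  under eq_finset => i do rewrite iter_eq_order //.
  have /(dvdn_pfactor _ _ p_prime)[a le_an ->] : (order (turn_state rho) s %| p ^ n)%N.
    by rewrite -iter_eq_order // stN.
  rewrite card_multiples_ord ?dvdn_exp2l // -expnB ?prime_gt0 //.
  rewrite !eqn_exp2l ?prime_gt1 //.
  by apply/eqP/eqP; lia.
pose F (s : state D) : {fraction {poly int}} := (- q) ^+ #|s| *
  \sum_(b | (st b == s) && (order sigma b == p ^ (n - m))%N) q ^ tensor_degree b.
have F_turn (s : state D) : F (turn_state rho s) = F s.
  rewrite /F card_imset //; congr (_ * _).
  rewrite (reindex_inj sig_inj); apply: eq_big => [b|b _].
    by rewrite st_turn (inj_eq st_inj) order_f.
  by rewrite tensor_degree_turn.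
(* The orbit of an enhanced state maps onto that of its state, so the length of the latter divides
   that of the former. *)
have F0 (s : state D) : ~~ (order (turn_state rho) s %| p ^ (n - m))%N -> F s = 0.
  move=> ndvd; rewrite /F big_pred0 ?mulr0 // => b; apply: contraNF ndvd.
  move=> /andP[/eqP <- /eqP <-]; rewrite -iter_eq_order // -st_iter_turn //.
  by rewrite iter_order.
apply: (mulrn_fraction_inj (pk_gt0 (n - m)%N)).
rewrite (difference_jones_orbits opp_turn cross_inj loop_inj oddN crossN sigN p_prime
  (leq_subr m n) ord_dvd) -mulrnAr -sumrMnl.
transitivity ((-1) ^+ n_neg D * q ^ ((n_pos D)%:Z - 2 * (n_neg D)%:Z) * \sum_s F s).
  rewrite /F; under [in RHS]eq_bigr => s _ do rewrite mulr_sumr.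
  rewrite (exchange_big_dep (fun b => (order sigma b == p ^ (n - m))%N)) /=; last first.
    by move=> s b _ /andP[].
  rewrite mulr_sumr; apply: eq_bigr => b ord_b.
  rewrite (big_pred1 (st b)); last by move=> s /=; rewrite ord_b andbT eq_sym.
  exact: weightE.
congr (_ * _).
(* A state with orbit length p^a occurs for v = n - a only; if a > n - m, so that v < m, it
   contributes 0 by [F0]. *)
transitivity (\sum_(m <= v < n.+1)
    \sum_(s | (order (turn_state rho) s == p ^ (n - v))%N) F s).
  rewrite (exchange_big_dep predT) //=; apply: eq_bigr => s _.
  have [dv|/F0->] := boolP (order (turn_state rho) s %| p ^ (n - m))%N; last first.
    by rewrite big1.
  have /(dvdn_pfactor _ _ p_prime)[a le_a aE] := dv.
  rewrite big_mkcond (bigD1_seq (n - a)%N) ?iota_uniq //=; last first.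
    by rewrite mem_index_iota; lia.
  have le_an : (a <= n)%N by lia.
  rewrite aE subKn // eqxx big1_seq ?addr0 // => v /andP[neq].
  rewrite mem_index_iota eqn_exp2l ?prime_gt1 // => /andP[le_mv le_vn].
  by rewrite ifF //; apply/eqP; move/eqP: neq; lia.
rewrite !big_nat; apply: eq_bigr => v /andP[le_mv le_vn].
(* Passing to representatives produces the orbit length p^(n-v), which together with p^(v-m) from
   [difference_jones_state] makes p^(n-m). *)
rewrite (sum_froots st_inj) => [|s|]; [|by rewrite order_f|exact: F_turn].
rewrite -sumrMnl; apply: eq_big => [s|s /andP[_ /eqP ord_s]].
  by rewrite inE symE // andbC.
have fix_s : iter (p ^ (n - v)) (turn_state rho) s = s by rewrite -ord_s iter_order.
rewrite ord_s /F -(difference_jones_state opp_turn cross_inj loop_inj fix_s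
  p_prime p_odd _ le_mv crossN loopN (erefl _) ord_s) //.
rewrite mulrnAr -mulrnA -expnD; congr (_ *+ (_ ^ _)%N); lia.
Qed.
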